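(* Let $r\ge 1$ be an integer and let $G$ be an $(r,1,3;+1)$-graph, i.e. a $3$-geodetic mixed graph with minimum undirected degree $\ge r$, minimum directed out-degree $\ge 1$ and order $M(r,1,3)+1$. Then $G$ is totally regular.
   Context: A mixed graph $G$ consists of a finite set $V(G)$ of vertices, a set $E(G)$ of unordered pairs of vertices (edges, $u\sim v$) and a set $A(G)$ of ordered pairs (arcs, $u\to v$). There are no loops and no parallel edges or arcs, and $u\sim v$ and $u\to v$ cannot hold simultaneously. Mixed graphs are assumed proper: both $E(G)$ and $A(G)$ are non-empty. The undirected degree of $u$ is $d(u)=|\{v:u\sim v\}|$, the directed out-degree is $d^+(u)=|\{v:u\to v\}|$ and the directed in-degree is $d^-(u)=|\{v:v\to u\}|$. A mixed path of length $t$ is a walk $u_0u_1\dots u_t$ with $u_i\sim u_{i+1}$ or $u_i\to u_{i+1}$ for each $i$ that is non-backtracking, i.e. contains no sub-walk $u_i\sim u_{i+1}\sim u_i$ (length $0$ is allowed). $G$ is $k$-geodetic if for any ordered pair of (not necessarily distinct) vertices $u,v$ there is at most one mixed path from $u$ to $v$ of length $\le k$. The mixed Moore bound is \[ M(r,z,k)=A\frac{u_1^{k+1}-1}{u_1-1}+B\frac{u_2^{k+1}-1}{u_2-1},\] where $v=(z+r)^2+2(z-r)+1$, $u_1=\frac{z+r-1-\sqrt v}{2}$, $u_2=\frac{z+r-1+\sqrt v}{2}$, $A=\frac{\sqrt v-(z+r+1)}{2\sqrt v}$, $B=\frac{\sqrt v+(z+r+1)}{2\sqrt v}$ (this is the number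 of mixed paths of length $\le k$ starting at a vertex when all undirected degrees are $r$ and all directed out-degrees are $z$). $G$ is out-regular if $d(u)=d(v)$ and $d^+(u)=d^+(v)$ for all vertices $u,v$; it is totally regular if it is out-regular and $d^-(u)=d^+(u)$ for every vertex $u$. *)

(* Defs.v *)
From mathcomp Require Import all_boot all_order all_algebra.

Set Implicit Arguments.
Unset Strict Implicit.
Unset Printing Implicit Defensive.

Import GRing.Theory Num.Theory.
Local Open Scope ring_scope.

(* Proper finite mixed graphs.  Nothing here forbids [arc u v] and [arc v u]
   together; that is excluded by k-geodecity when k >= 2. *)
Record mixed_graph := MixedGraph {
  vertex :> finType;
  edge : rel vertex;
  arc : rel vertex;
  edge_sym : symmetric edge;
  edge_irr : irreflexive edge;
  arc_irr : irreflexive arc;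
  edge_not_arc : forall u v, edge u v -> ~~ arc u v;
  edge_nonempty : exists u v, edge u v;
  arc_nonempty : exists u v, arc u v
}.

Section MixedGraph.
Variable G : mixed_graph.
Implicit Types (u v : G) (p q s : seq G).

Definition undirected_degree u : nat := #|[set v | edge u v]|.
Definition out_degree u : nat := #|[set v | arc u v]|.
Definition in_degree u : nat := #|[set v | arc v u]|.

Definition step : rel G := fun u v => edge u v || arc u v.

Fixpoint nonbacktracking s : bool :=
  match s with
  | x :: ((y :: z :: _) as s') =>
      ~~ [&& edge x y, edge y z & z == x] && nonbacktracking s'
  | _ => true
  end.

(* [mixed_path u p]: the vertex sequence u :: p is a mixed path, of length
   [size p], from u to [last u p].  Since an edge and an arc never join the
   same pair, the vertex sequence determines the edges and arcs used. *)
Definition mixed_path u p : bool := path step u p && nonbacktracking (u :: p).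

Definition geodetic (k : nat) : Prop :=
  forall u v p q,
    mixed_path u p -> last u p = v -> (size p <= k)%N ->
    mixed_path u q -> last u q = v -> (size q <= k)%N ->
    p = q.

Definition out_regular : Prop :=
  forall u v, undirected_degree u = undirected_degree v
           /\ out_degree u = out_degree v.

Definition totally_regular : Prop :=
  out_regular /\ forall u, in_degree u = out_degree u.

End MixedGraph.

Definition moore_bound (R : rcfType) (r z k : nat) : R :=
  let r' : R := r%:R in
  let z' : R := z%:R in
  let v := (z' + r') ^+ 2 + 2 * (z' - r') + 1 in
  let u1 := (z' + r' - 1 - Num.sqrt v) / 2 in
  let u2 := (z' + r' - 1 + Num.sqrt v) / 2 in
  let A := (Num.sqrt v - (z' + r' + 1)) / (2 * Num.sqrt v) in
  let B := (Num.sqrt v + (z' + r' + 1)) / (2 * Num.sqrt v) in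
  A * ((u1 ^+ k.+1 - 1) / (u1 - 1)) + B * ((u2 ^+ k.+1 - 1) / (u2 - 1)).

(* (r, z, k; +eps)-graphs, the order being compared with the Moore bound
   inside the real closed field R. *)
Definition excess_graph (R : rcfType) (r z k eps : nat) (G : mixed_graph) :
    Prop :=
  [/\ geodetic G k,
      forall u : G, (r <= undirected_degree u)%N,
      forall u : G, (z <= out_degree u)%N
    & #|G|%:R = moore_bound R r z k + eps%:R].

(* Main.v *)
From mathcomp Require Import all_boot all_order all_algebra.
From mathcomp Require Import ring lra zify.
Require Import Defs.
Set Implicit Arguments.
Unset Strict Implicit.
Unset Printing Implicit Defensive.
Import Order.TTheory GRing.Theory Num.Theory.
Local Open Scope ring_scope.

(** Let T = E + P be the adjacency matrix of the steps ([stepM]), E for the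
    edges ([edgeM]) and P for the arcs ([arcM]), and let F be the matrix that
    counts mixed paths of length at most 3 ([npaths]).  Removing the
    backtracking walks from I + T + T^2 + T^3 expresses F by T, E and the
    undirected degrees ([npathsE]), hence as a polynomial in T and E once these
    are constant ([npaths_regE]); 3-geodecity says that F has entries 0 and 1.

    Out-regularity.  The row sums of F are at most the order of G, which is one
    more than the Moore bound; an additional edge or arc at a vertex creates at
    least two additional paths ([sum_npaths_ge], [out_degrees]).

    In-degrees.  Each row of F now has exactly one zero, so O = J - F, with J
    the all-ones matrix, is a 0-1 matrix with a single 1 in each row: row u
    marks the outlier of u, the vertex that u does not reach.  As F is a
    polynomial in T up to the summand E, the commutator of T and O is easy to
    compute ([step_outlier_commutator]):
      (T O)(u, v) = (O T)(u, v) - e(v) - (P E)(u, v) + (E P)(u, v),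
    where e(v) is the in-degree of v minus 1 ([surplus]).  As the products are
    nonnegative and the entries of O T are at most 1, this identity has strong
    consequences:
    - at u = v it gives e <= 1, so that each vertex is regular, a source
      (in-degree 0) or a sink (in-degree 2), with as many sources as sinks;
    - summed over u at a source s, it shows that s is the outlier of more than
      2r vertices ([col_outlierM_source]);
    - at a sink t, for each u either the outlier of u has a step to t or there
      is a path u ~ w -> t, and the latter holds for at most 2r vertices u.
    Hence each source has a step to each sink ([source_to_sink]).  Two sources
    and two sinks would then span a square, which contradicts 3-geodecity
    ([sinks_eq]).  With a single source s and a single sink t, the column sums
    of F give too many paths into t: lacking one arc into s loses at most r + 2
    of them, against the r^2 + r + 3 gained by the second arc into t
    ([single_source_sink_absurd]). *)

(** * Integer matrices indexed by a finite type *)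

Section Kernels.
Variable V : finType.
Implicit Types K L M : V -> V -> int.

(** The matrix product, with entries indexed by V itself rather than by an
    ordinal, so that no enumeration of the vertices intervenes. *)
Definition comp K L : V -> V -> int := fun u v => \sum_w K u w * L w v.

Lemma comp_assoc K L M u v : comp (comp K L) M u v = comp K (comp L M) u v.
Proof.
rewrite /comp; under eq_bigr do rewrite mulr_suml.
rewrite exchange_big /=; apply: eq_bigr => a _.
by rewrite mulr_sumr; apply: eq_bigr => b _; rewrite mulrA.
Qed.

Lemma sum_row_comp K L u : \sum_v comp K L u v = \sum_w K u w * \sum_v L w v.
Proof. by rewrite exchange_big; apply: eq_bigr => w _; rewrite mulr_sumr. Qed.

Lemma sum_col_comp K L v : \sum_u comp K L u v = \sum_w (\sum_u K u w) * L w v.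
Proof. by rewrite exchange_big; apply: eq_bigr => w _; rewrite mulr_suml. Qed.

Lemma comp_ge0 K L u v :
  (forall a b, 0 <= K a b) -> (forall a b, 0 <= L a b) -> 0 <= comp K L u v.
Proof. by move=> K0 L0; apply: sumr_ge0 => w _; apply: mulr_ge0. Qed.

Lemma sum_delta (f : V -> int) u : \sum_v (v == u)%:R * f v = f u.
Proof.
rewrite (bigD1 u) //= eqxx mul1r big1 ?addr0 // => v /negbTE -> /=.
exact: mul0r.
Qed.

Lemma le_single (f : V -> int) u :
  (forall v, 0 <= f v) -> f u <= \sum_v f v.
Proof.
by move=> f0; rewrite (bigD1 u) //= lerDl; apply: sumr_ge0 => v _; apply: f0.
Qed.

Lemma card_set_sum (p : pred V) : #|[set v | p v]|%:R = \sum_v (p v)%:R :> int.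
Proof.
rewrite -sum1dep_card natr_sum big_mkcond.
by apply: eq_bigr => v _; case: (p v).
Qed.

Lemma sum_bool_le1 (p : pred V) :
  (forall a b, p a -> p b -> a = b) -> \sum_v (p v)%:R <= 1 :> int.
Proof.
move=> p_uniq; rewrite -card_set_sum (ler_nat _ _ 1).
by apply/card_le1_eqP => a b; rewrite !inE => pa pb; apply: p_uniq.
Qed.
End Kernels.

(** * Counting mixed paths of length at most 3 *)

Section PathCounts.
Variable G : mixed_graph.
Implicit Types u v w s t : G.

Definition edgeM u v : int := (edge u v)%:R.
Definition arcM u v : int := (arc u v)%:R.
Definition stepM u v : int := (step u v)%:R.
Definition idM u v : int := (u == v)%:R.
Definition walk2 := comp stepM stepM.
Definition walk3 := comp stepM walk2.
Definition udeg u : int := \sum_v edgeM u v.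
Definition odeg u : int := \sum_v arcM u v.

Definition npaths u v : int :=
  idM u v + (mixed_path u [:: v])%:R + \sum_a (mixed_path u [:: a; v])%:R
  + \sum_a \sum_b (mixed_path u [:: a; b; v])%:R.

(** The summands of [npaths u v] are indexed by the intermediate vertices, and
    distinct indices give distinct paths from u to v. *)
Lemma npaths_le1 u v : geodetic G 3 -> npaths u v <= 1.
Proof.
move=> geo.
pose sq (i : unit + (unit + (G + G * G))) : seq G :=
  match i with
  | inl _ => [::] | inr (inl _) => [:: v]
  | inr (inr (inl a)) => [:: a; v] | inr (inr (inr ab)) => [:: ab.1; ab.2; v]
  end.
have sq_inj : injective sq.
  by case=> [[]|[[]|[a|[a b]]]] [[]|[[]|[c|[c d]]]] //= => [[->] | [-> ->]].
have := @sum_bool_le1 _ (fun i => mixed_path u (sq i) && (last u (sq i) == v)).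
have sum_unit (F : unit -> int) : \sum_i F i = F tt.
  by rewrite (big_pred1 tt) => [|[]].
rewrite !big_sumType !sum_unit /= eqxx andbT.
rewrite -(pair_bigA _
  (fun a b => (mixed_path u [:: a; b; v] && true)%:R : int)) /=.
under [X in _ + (_ + (X + _))]eq_bigr do rewrite andbT.
under [X in _ + (_ + (_ + X))]eq_bigr do under eq_bigr do rewrite andbT.
rewrite /npaths /idM -!addrA; apply => i j /andP[pi /eqP li] /andP[pj /eqP lj].
have sz k : (size (sq k) <= 3)%N by case: k => [[]|[[]|[a|[a b]]]].
by apply: sq_inj; apply: (geo u v).
Qed.

Lemma stepM_split u v : stepM u v = edgeM u v + arcM u v.
Proof.
rewrite /stepM /edgeM /arcM /step.
have [/edge_not_arc/negbTE->|_] //= := boolP (edge u v).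
by rewrite add0r.
Qed.

Lemma edgeM_sym u v : edgeM u v = edgeM v u.
Proof. by rewrite /edgeM edge_sym. Qed.

Lemma mixed_path1E u v : (mixed_path u [:: v])%:R = stepM u v.
Proof. by rewrite /mixed_path /= !andbT. Qed.

Lemma mixed_path2E u a v :
  (mixed_path u [:: a; v])%:R
  = stepM u a * stepM a v - (v == u)%:R * (edgeM u a * edgeM a u).
Proof.
rewrite /mixed_path /= !andbT /stepM /edgeM /step.
case: (eqVneq v u) => [->|vu] /=; last first.
  rewrite mul0r.
  by case: (edge u a); case: (arc u a); case: (edge a v); case: (arc a v).
by case: (edge u a); case: (arc u a); case: (edge a u); case: (arc a u).
Qed.

(** Inclusion-exclusion over the two places where a walk of length 3 may
    backtrack; it does so at both exactly when it runs along one edge three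
    times. *)
Lemma mixed_path3E u a b v :
  (mixed_path u [:: a; b; v])%:R
  = stepM u a * (stepM a b * stepM b v)
    - (b == u)%:R * (edgeM u a * edgeM a u * stepM u v)
    - (a == v)%:R * (edgeM v b * edgeM b v * stepM u v)
    + (a == v)%:R * ((b == u)%:R * edgeM u v).
Proof.
rewrite /mixed_path /= !andbT /stepM /edgeM /step.
rewrite [v == a]eq_sym.
have [->|bu] := eqVneq b u; have [->|av] := eqVneq a v => /=.
- rewrite !mul1r (edge_sym v u).
  by case: (edge u v); case: (arc u v); case: (arc v u).
- rewrite !mul0r !mul1r.
  by case: (edge u a); case: (arc u a); case: (edge a u); case: (arc a u);
    case: (edge u v); case: (arc u v).
- rewrite !mul0r !mul1r.
  by case: (edge v b); case: (arc v b); case: (edge b v); case: (arc b v);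
    case: (edge u v); case: (arc u v).
rewrite !mul0r.
by case: (edge u a); case: (arc u a);
  case: (edge a b); case: (arc a b); case: (edge b v); case: (arc b v).
Qed.

Lemma sum_path2 u v :
  \sum_a (mixed_path u [:: a; v])%:R = walk2 u v - idM u v * udeg u.
Proof.
under eq_bigr do rewrite mixed_path2E.
rewrite sumrB -mulr_sumr; congr (_ - _ * _); first by rewrite /idM eq_sym.
by apply: eq_bigr => a _; rewrite (edgeM_sym a) /edgeM; case: edge.
Qed.

Lemma npathsE u v :
  npaths u v = idM u v + stepM u v + (walk2 u v - idM u v * udeg u)
    + (walk3 u v - udeg u * stepM u v - stepM u v * udeg v + edgeM u v).
Proof.
rewrite /npaths mixed_path1E sum_path2; congr (_ + _).
under eq_bigr => a _.
  under eq_bigr do rewrite mixed_path3E.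
  rewrite big_split !sumrB /= -!mulr_sumr !sum_delta.
  over.
rewrite big_split !sumrB /= !sum_delta; congr (_ - _ - _ + _).
  rewrite -mulr_suml; congr (_ * _).
  by apply: eq_bigr => a _; rewrite (edgeM_sym a) /edgeM; case: edge.
rewrite mulrC -mulr_suml; congr (_ * _).
by apply: eq_bigr => b _; rewrite (edgeM_sym b) /edgeM; case: edge.
Qed.

(** * Out-regularity *)
Definition valency u : int := \sum_v stepM u v.

Lemma edgeM_ge0 u v : 0 <= edgeM u v. Proof. by rewrite /edgeM; case: edge. Qed.
Lemma arcM_ge0 u v : 0 <= arcM u v. Proof. by rewrite /arcM; case: arc. Qed.
Lemma stepM_ge0 u v : 0 <= stepM u v. Proof. by rewrite /stepM; case: step. Qed.
Lemma stepM_le1 u v : stepM u v <= 1. Proof. by rewrite /stepM; case: step. Qed.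
Lemma edgeM_le_stepM u v : edgeM u v <= stepM u v.
Proof. by rewrite stepM_split lerDl arcM_ge0. Qed.

Lemma valencyE u : valency u = udeg u + odeg u.
Proof.
by rewrite /valency -big_split; apply: eq_bigr => v _; rewrite stepM_split.
Qed.

Lemma sum_idM u : \sum_v idM u v = 1.
Proof.
rewrite -[RHS](sum_delta (fun _ => 1) u).
by apply: eq_bigr => v _; rewrite mulr1 /idM eq_sym.
Qed.

Lemma sum_npaths u : \sum_v npaths u v =
  1 + valency u - udeg u * valency u
  + \sum_a stepM u a * (valency a + \sum_b stepM a b * valency b - udeg a).
Proof.
under eq_bigr do rewrite npathsE.
have -> : \sum_a stepM u a * (valency a + \sum_b stepM a b * valency b - udeg a)
  = \sum_v walk2 u v + \sum_v walk3 u v - \sum_v stepM u v * udeg v.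
  rewrite !sum_row_comp -big_split -sumrB /=; apply: eq_bigr => a _.
  by rewrite sum_row_comp -mulrDr -mulrBr.
rewrite !(big_split, sumrN) /= -mulr_suml -mulr_sumr sum_idM.
rewrite -/(valency u) -/(udeg u).
ring.
Qed.

Section Minimum.
Variable r : nat.
Hypothesis udeg_ge : forall u, r%:R <= udeg u.
Hypothesis odeg_ge : forall u, 1 <= odeg u.

(** The bound counts paths as if all vertices except u had undirected degree r
    and out-degree 1: an arc from u opens a tree of r^2 + 2r + 3 paths, and an
    edge, from whose far end the path may not return to u, one of
    r^2 + r + 2. *)
Lemma sum_npaths_ge u :
  1 + odeg u * (r%:R ^+ 2 + 2 * r%:R + 3) + udeg u * (r%:R ^+ 2 + r%:R + 2)
    <= \sum_v npaths u v.
Proof.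
have D_ge v : r%:R + 1 <= valency v by rewrite valencyE lerD.
(* The term b = u is kept apart: when a is joined to u by an edge, u is among
   the out-neighbours of a, and its possibly larger valency is exactly what
   pays for the backtracking walks subtracted in [sum_npaths]. *)
have lb2 a : (r%:R + 1) * valency a + edgeM a u * (valency u - (r%:R + 1))
    <= \sum_b stepM a b * valency b.
  rewrite -lerBrDl.
  have -> : \sum_b stepM a b * valency b - (r%:R + 1) * valency a
            = \sum_b stepM a b * (valency b - (r%:R + 1)).
    rewrite mulr_sumr -sumrB; apply: eq_bigr => b _; ring.
  apply: (@le_trans _ _ (stepM a u * (valency u - (r%:R + 1)))).
    by rewrite ler_wpM2r ?subr_ge0 ?D_ge ?edgeM_le_stepM.
  apply: (@le_single _ (fun b => stepM a b * (valency b - (r%:R + 1)))) => b.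
  by rewrite mulr_ge0 ?stepM_ge0 ?subr_ge0 ?D_ge.
have lb1 a :
    stepM u a * (1 + (r%:R + 1) ^+ 2) + edgeM u a * (valency u - (r%:R + 1))
    <= stepM u a * (valency a + \sum_b stepM a b * valency b - udeg a).
  have := lb2 a; have := D_ge a; have := odeg_ge a; have := valencyE a.
  rewrite edgeM_sym; have := edgeM_le_stepM u a; have := stepM_ge0 u a.
  rewrite /stepM /edgeM.
  case: step; case: edge => //= _ _; nia.
rewrite sum_npaths.
apply: le_trans (lerD (lexx _) (ler_sum _ (fun a _ => lb1 a))).
rewrite big_split /= -!mulr_suml -/(valency u) -/(udeg u) valencyE.
by rewrite le_eqVlt; apply/orP; left; apply/eqP; ring.
Qed.

(** With degrees r and 1, the bound of [sum_npaths_ge] is the order minus 1;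
    enlarging either degree adds at least 2 to it. *)
Lemma out_degrees : geodetic G 3 ->
  #|G|%:R = r%:R ^+ 3 + 2 * r%:R ^+ 2 + 4 * r%:R + 5 :> int ->
  forall u, udeg u = r%:R /\ odeg u = 1.
Proof.
move=> geo cardG u.
have : \sum_v npaths u v <= #|G|%:R.
  by rewrite -sumr_const; apply: ler_sum => v _; apply: npaths_le1.
rewrite cardG; move: (sum_npaths_ge u) (udeg_ge u) (odeg_ge u) => h1 h2 h3 h4.
have r0 : 0 <= r%:R :> int by [].
by split; nia.
Qed.
End Minimum.

(** * In-regularity *)

Section Regular.
Variable r : int.
Hypothesis r_ge1 : 1 <= r.
Hypothesis udeg_r : forall u, udeg u = r.
Hypothesis odeg_1 : forall u, odeg u = 1.
Hypothesis geo : geodetic G 3.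
Hypothesis cardG : #|G|%:R = r ^+ 3 + 2 * r ^+ 2 + 4 * r + 5 :> int.

Definition surplus v : int := \sum_u arcM u v - 1.
(** The matrix O = J - F; the row sums below show that each row is the
    indicator of a single vertex. *)
Definition outlierM u v : int := 1 - npaths u v.

Lemma valency_r u : valency u = r + 1.
Proof. by rewrite valencyE udeg_r odeg_1. Qed.

Lemma sum1_G : \sum_(u : G) 1 = r ^+ 3 + 2 * r ^+ 2 + 4 * r + 5 :> int.
Proof. by rewrite -cardG sumr_const. Qed.

Lemma npaths_regE u v :
  npaths u v = (1 - r) * idM u v + (1 - 2 * r) * stepM u v + walk2 u v
    + walk3 u v + edgeM u v.
Proof. rewrite npathsE !udeg_r; ring. Qed.

Lemma outlierM_ge0 u v : 0 <= outlierM u v.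
Proof. by rewrite subr_ge0 npaths_le1. Qed.

Lemma sum_outlierM u : \sum_v outlierM u v = 1.
Proof.
rewrite sumrB sum1_G sum_npaths valency_r udeg_r.
under eq_bigr do rewrite valency_r.
under eq_bigr do under eq_bigr do rewrite valency_r.
under eq_bigr do rewrite -mulr_suml -/(valency _) valency_r udeg_r.
rewrite -mulr_suml -/(valency u) valency_r; ring.
Qed.

Lemma col_edgeM v : \sum_u edgeM u v = r.
Proof. by rewrite -(udeg_r v); apply: eq_bigr => u _; rewrite edgeM_sym. Qed.

Lemma col_stepM v : \sum_u stepM u v = r + 1 + surplus v.
Proof.
under eq_bigr do rewrite stepM_split.
rewrite big_split /= col_edgeM /surplus; ring.
Qed.

(** In F the only summand that does not commute with T is E, and
    T E - E T = P E - E P.  The all-ones matrix J contributes -e(v), because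
    the row sums of T are constant but its column sums are r + 1 + e(v). *)
Lemma step_outlier_commutator u v :
  comp stepM outlierM u v = comp outlierM stepM u v - surplus v
    - comp arcM edgeM u v + comp edgeM arcM u v.
Proof.
have TO : comp stepM outlierM u v = r + 1 - comp stepM npaths u v.
  rewrite /comp -(valency_r u) /valency -sumrB; apply: eq_bigr => w _.
  rewrite /outlierM; ring.
have OT : comp outlierM stepM u v = r + 1 + surplus v - comp npaths stepM u v.
  rewrite /comp -col_stepM -sumrB; apply: eq_bigr => w _.
  rewrite /outlierM; ring.
have TF : comp stepM npaths u v = (1 - r) * stepM u v + (1 - 2 * r) * walk2 u v
            + walk3 u v + comp stepM walk3 u v + comp stepM edgeM u v.
  have TI : stepM u v = \sum_w stepM u w * idM w v.
    rewrite -[LHS](sum_delta (stepM u) v); apply: eq_bigr => w _; exact: mulrC.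
  rewrite {1}TI !mulr_sumr -!big_split; apply: eq_bigr => w _ /=.
  rewrite npaths_regE; ring.
have FT : comp npaths stepM u v = (1 - r) * stepM u v + (1 - 2 * r) * walk2 u v
            + walk3 u v + comp stepM walk3 u v + comp edgeM stepM u v.
  have IT : stepM u v = \sum_w idM u w * stepM w v.
    rewrite -[LHS](sum_delta (fun w => stepM w v) u).
    by apply: eq_bigr => w _; rewrite /idM eq_sym.
  have T3l : comp stepM walk3 u v = comp walk3 stepM u v.
    rewrite [RHS]comp_assoc; apply: eq_bigr => w _.
    by rewrite [comp walk2 stepM w v]comp_assoc.
  rewrite T3l {1}IT -[walk3 u v](comp_assoc stepM stepM stepM).
  rewrite !mulr_sumr -!big_split; apply: eq_bigr => w _ /=.
  rewrite npaths_regE; ring.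
have TE : comp stepM edgeM u v = comp edgeM edgeM u v + comp arcM edgeM u v.
  by rewrite -big_split; apply: eq_bigr => w _ /=; rewrite stepM_split mulrDl.
have ET : comp edgeM stepM u v = comp edgeM edgeM u v + comp edgeM arcM u v.
  by rewrite -big_split; apply: eq_bigr => w _ /=; rewrite stepM_split mulrDr.
rewrite TO OT TF FT TE ET; ring.
Qed.

(** The row vector 1 is an eigenvector of T up to the defect e, that is
    1 T = (r + 1) 1 + e; propagating this through the powers of T turns the
    column sums of F into those of the totally regular case plus a linear form
    in e. *)
Lemma col_outlierM v : \sum_u outlierM u v =
  1 - \sum_w surplus w * (walk2 w v + (r + 2) * stepM w v)
    - (r ^+ 2 + r + 3) * surplus v.
Proof.
rewrite sumrB sum1_G.
under eq_bigr do rewrite npaths_regE.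
rewrite !big_split /= -!mulr_sumr col_edgeM col_stepM !sum_col_comp.
have split_col K : \sum_w (\sum_u stepM u w) * K w v
    = (r + 1) * \sum_w K w v + \sum_w surplus w * K w v.
  rewrite mulr_sumr -big_split; apply: eq_bigr => w _ /=.
  rewrite col_stepM; ring.
rewrite !split_col sum_col_comp split_col col_stepM.
have -> : \sum_u idM u v = 1.
  by rewrite -(sum_idM v); apply: eq_bigr => w _; rewrite /idM eq_sym.
have -> : \sum_w surplus w * (walk2 w v + (r + 2) * stepM w v)
    = \sum_w surplus w * walk2 w v + (r + 2) * \sum_w surplus w * stepM w v.
  rewrite mulr_sumr -big_split; apply: eq_bigr => w _ /=; ring.
ring.
Qed.

Lemma surplus_ge u : -1 <= surplus u.
Proof. by rewrite lerBrDl subrr sumr_ge0 // => v _; apply: arcM_ge0. Qed.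

Lemma step_outlier_ge0 u v : 0 <= comp stepM outlierM u v.
Proof. exact: comp_ge0 stepM_ge0 outlierM_ge0. Qed.

Lemma outlier_step_ge0 u v : 0 <= comp outlierM stepM u v.
Proof. exact: comp_ge0 outlierM_ge0 stepM_ge0. Qed.

Lemma arc_edge_ge0 u v : 0 <= comp arcM edgeM u v.
Proof. exact: comp_ge0 arcM_ge0 edgeM_ge0. Qed.

Lemma outlier_step_le1 u v : comp outlierM stepM u v <= 1.
Proof.
rewrite -(sum_outlierM u); apply: ler_sum => w _.
by rewrite ler_piMr ?outlierM_ge0 ?stepM_le1.
Qed.

(** On the diagonal E P vanishes, as it would need an edge and an arc joining
    the same two vertices. *)
Lemma surplus_le1 v : surplus v <= 1.
Proof.
have EP0 : comp edgeM arcM v v = 0.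
  apply: big1 => w _; rewrite edgeM_sym /edgeM /arcM.
  by have [/edge_not_arc/negbTE->|_] := boolP (edge w v); rewrite ?mulr0 ?mul0r.
have := step_outlier_ge0 v v; have := arc_edge_ge0 v v.
have := outlier_step_le1 v v; have := step_outlier_commutator v v; lia.
Qed.

(** By the commutator identity, every u, apart from at most 2r exceptions, has
    an out-neighbour with outlier s, whereas each vertex with outlier s serves
    at most r + 2 such u.  The quotient of r^3 + 2r^2 + 2r + 5 by r + 2 exceeds
    2r. *)
Lemma col_outlierM_source s : surplus s = -1 -> 2 * r < \sum_u outlierM u s.
Proof.
move=> es.
have Ps w : arcM w s = 0.
  have Pge0 := fun u => arcM_ge0 u s.
  apply: le_anti; rewrite Pge0 andbT.
  have := le_single w Pge0; move: es; rewrite /surplus; lia.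
have comm u : comp stepM outlierM u s
    = comp outlierM stepM u s + 1 - comp arcM edgeM u s.
  have -> : comp outlierM stepM u s + 1 - comp arcM edgeM u s
    = comp outlierM stepM u s - surplus s - comp arcM edgeM u s + 0.
    by rewrite es; ring.
  rewrite step_outlier_commutator; congr (_ + _).
  by apply: big1 => w _; rewrite Ps mulr0.
have le_TO : \sum_u comp stepM outlierM u s <= (r + 2) * \sum_u outlierM u s.
  rewrite sum_col_comp mulr_sumr; apply: ler_sum => w _.
  rewrite col_stepM; have := surplus_le1 w; have := outlierM_ge0 w s; nia.
have OT_ge0 : 0 <= \sum_u comp outlierM stepM u s.
  by apply: sumr_ge0 => u _; apply: outlier_step_ge0.
have le_PE : \sum_u comp arcM edgeM u s <= 2 * r.
  rewrite sum_col_comp -(col_edgeM s) mulr_sumr; apply: ler_sum => w _.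
  rewrite ler_wpM2r ?edgeM_ge0 //.
  by have := surplus_le1 w; rewrite /surplus; lia.
have : \sum_u comp stepM outlierM u s
    = \sum_u comp outlierM stepM u s + \sum_(u : G) 1
      - \sum_u comp arcM edgeM u s.
  by rewrite -big_split -sumrB; apply: eq_bigr => u _; apply: comm.
rewrite sum1_G; nia.
Qed.

(** Otherwise each u with outlier s would have a path u ~ w -> t, by the
    commutator identity at t; but there are only 2r such paths, as t has
    in-degree 2. *)
Lemma source_to_sink s t : surplus s = -1 -> surplus t = 1 -> stepM s t = 1.
Proof.
move=> es et.
suff : stepM s t != 0 by rewrite /stepM; case: step.
apply/eqP => Tst.
have le_EP u : outlierM u s <= comp edgeM arcM u t.
  have : outlierM u s + comp outlierM stepM u t <= 1.
    rewrite -(sum_outlierM u) -(sum_delta (outlierM u) s) -big_split.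
    apply: ler_sum => w _ /=.
    have [->|_] := eqVneq w s; first by rewrite Tst mul1r mulr0 addr0.
    by rewrite mul0r add0r ler_piMr ?outlierM_ge0 ?stepM_le1.
  have := step_outlier_ge0 u t; have := arc_edge_ge0 u t.
  have := step_outlier_commutator u t; rewrite et; lia.
have : \sum_u outlierM u s <= \sum_u comp edgeM arcM u t.
  by apply: ler_sum => u _.
rewrite [leRHS]sum_col_comp; under [leRHS]eq_bigr do rewrite col_edgeM.
have -> : \sum_w r * arcM w t = r * (surplus t + 1) by rewrite -mulr_sumr subrK.
rewrite et; have := col_outlierM_source es; lia.
Qed.

(** The paths s' t s t' and s' t' of lengths 3 and 1 have the same ends.  The
    edge is what allows the step from t back to s. *)
Lemma geodetic_no_square s s' t t' :
  edge s t -> step s t' -> step s' t -> step s' t' ->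
  s != s' -> t != t' -> False.
Proof.
move=> st st' s't s't' ss' tt'.
suff : [:: t; s; t'] = [:: t'] by [].
apply: (geo (u := s') (v := t')) => //; rewrite /mixed_path /= ?s't' //.
rewrite s't st' [step t s]/step edge_sym st /= (negbTE ss') [t' == t]eq_sym.
by rewrite (negbTE tt') !andbF.
Qed.

Lemma stepM1_step u v : stepM u v = 1 -> step u v.
Proof. by rewrite /stepM; case: step. Qed.

(** The steps from s to t and t' are not both arcs because s has out-degree 1,
    so one of them is an edge, and the four vertices form the square excluded by
    [geodetic_no_square]. *)
Lemma sinks_eq s s' t t' :
  surplus s = -1 -> surplus s' = -1 -> surplus t = 1 -> surplus t' = 1 ->
  s != s' -> t = t'.
Proof.
move=> es es' et et' ss'; apply/eqP/negPn/negP => tt'.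
have adj a b : surplus a = -1 -> surplus b = 1 -> step a b.
  by move=> ea eb; apply/stepM1_step/source_to_sink.
have [st|nst] := boolP (edge s t).
  by apply: (geodetic_no_square st _ _ _ ss' tt'); apply: adj.
have [st'|nst'] := boolP (edge s t').
  rewrite eq_sym in tt'.
  by apply: (geodetic_no_square st' _ _ _ ss' tt'); apply: adj.
have := adj _ _ es et; rewrite /step (negbTE nst) /= => ast.
have := adj _ _ es et'; rewrite /step (negbTE nst') /= => ast'.
have : arcM s t + arcM s t' <= odeg s.
  rewrite /odeg (bigD1 t) //= (bigD1 t') 1?eq_sym //= addrA lerDl.
  by apply: sumr_ge0 => i _; apply: arcM_ge0.
by rewrite odeg_1 /arcM ast ast'.
Qed.

Lemma short_paths_le1 u v : u != v -> walk2 u v + stepM u v <= 1.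
Proof.
move=> uv; have := npaths_le1 u v geo.
rewrite /npaths sum_path2 mixed_path1E /idM (negbTE uv).
have : 0 <= \sum_a \sum_b (mixed_path u [:: a; b; v])%:R :> int.
  by apply: sumr_ge0 => a _; apply: sumr_ge0 => b _.
rewrite /=; lia.
Qed.

(** In the column sum of O at t the source contributes at most r + 2, as there
    is at most one path of length at most 2 from s to t, and t itself at most
    -(r^2 + r + 3); with the constant term 1 the sum would be negative. *)
Lemma single_source_sink_absurd s t :
  s != t -> (forall w, surplus w = (w == t)%:R - (w == s)%:R) -> False.
Proof.
move=> st eE.
have : 0 <= \sum_u outlierM u t by apply: sumr_ge0 => u _; apply: outlierM_ge0.
rewrite col_outlierM; under eq_bigr do rewrite eE mulrBl.
rewrite sumrB !sum_delta eE eqxx eq_sym (negbTE st) /=.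
have := short_paths_le1 st; have := stepM_le1 s t; have := stepM_ge0 s t.
have := stepM_ge0 t t.
have : 0 <= walk2 t t by apply: comp_ge0; apply: stepM_ge0.
nia.
Qed.

Lemma surplus_eq0 v : surplus v = 0.
Proof.
have eE w : surplus w = (surplus w == 1)%:R - (surplus w == -1)%:R.
  have := surplus_ge w; have := surplus_le1 w => h1 h2.
  have : surplus w = 1 \/ surplus w = 0 \/ surplus w = -1 by lia.
  by case=> [->|[->|->]].
pose A := [set w | surplus w == 1]; pose B := [set w | surplus w == -1].
have cardAB : #|A| = #|B|.
  apply/eqP; rewrite -(eqr_nat int) -subr_eq0 !card_set_sum -sumrB.
  under eq_bigr do rewrite -eE.
  rewrite sumrB exchange_big /= -sumrB big1 // => w _.
  by rewrite -/(odeg w) odeg_1 subrr.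
have [[|[|k]] Ak] : exists k, #|A| = k by exists #|A|.
- have A0 : A = set0 by apply/eqP; rewrite -cards_eq0 Ak.
  have B0 : B = set0 by apply/eqP; rewrite -cards_eq0 -cardAB Ak.
  have : v \notin A by rewrite A0 inE.
  have : v \notin B by rewrite B0 inE.
  by rewrite !inE => /negbTE hB /negbTE hA; rewrite eE hA hB.
- have /cards1P[t At] : #|A| == 1%N by rewrite Ak.
  have /cards1P[s Bs] : #|B| == 1%N by rewrite -cardAB Ak.
  have inA w : (surplus w == 1) = (w == t) by rewrite -(in_set1 w t) -At inE.
  have inB w : (surplus w == -1) = (w == s) by rewrite -(in_set1 w s) -Bs inE.
  have st : s != t.
    have := inA t; have := inB s; rewrite !eqxx => es et.
    by apply: contraTneq es => ->; rewrite (eqP et).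
  by case: (single_source_sink_absurd st) => w; rewrite -inA -inB; apply: eE.
have /card_gt1P[t [t' []]] : (1 < #|A|)%N by rewrite Ak.
have /card_gt1P[s [s' []]] : (1 < #|B|)%N by rewrite -cardAB Ak.
rewrite !inE => /eqP es /eqP es' ss' /eqP et /eqP et'.
by rewrite (sinks_eq es es' et et' ss') eqxx.
Qed.
End Regular.

(** * Degrees, order and total regularity *)

Lemma udegE u : (undirected_degree u)%:R = udeg u.
Proof. exact: card_set_sum. Qed.

Lemma odegE u : (out_degree u)%:R = odeg u.
Proof. exact: card_set_sum. Qed.

Lemma in_degreeE u : (in_degree u)%:R = \sum_v arcM v u.
Proof. exact: card_set_sum. Qed.
End PathCounts.

(** For z = 1 the discriminant is r^2 + 4.  Both roots differ from 1, as
    (r - 2)^2 <> r^2 + 4, so the two fractions are geometric sums and the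
    expression is symmetric in the roots. *)
Lemma moore_bound_arc1_len3 (R : rcfType) (r : nat) : (0 < r)%N ->
  moore_bound R r 1 3 = (r ^ 3 + 2 * r ^ 2 + 4 * r + 4)%N%:R.
Proof.
move=> r_gt0; rewrite /moore_bound.
set x : R := r%:R.
have -> : (r ^ 3 + 2 * r ^ 2 + 4 * r + 4)%N%:R
          = x ^+ 3 + 2 * x ^+ 2 + 4 * x + 4.
  by rewrite /x; ring.
have x_gt0 : 0 < x by rewrite ltr0n.
have -> : ((1 : nat)%:R + x) ^+ 2 + 2 * ((1 : nat)%:R - x) + 1 = x ^+ 2 + 4.
  by ring.
have v_gt0 : 0 < x ^+ 2 + 4 by nra.
set s := Num.sqrt _.
have s2 : s ^+ 2 = x ^+ 2 + 4 by rewrite sqr_sqrtr // ltW.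
have s_gt0 : 0 < s by rewrite sqrtr_gt0.
have geom (y : R) : y - 1 != 0 ->
    (y ^+ 4 - 1) / (y - 1) = y ^+ 3 + y ^+ 2 + y + 1.
  by move=> ?; field.
rewrite !geom; last 2 first.
- by apply/eqP=> h; nra.
- by apply/eqP=> h; nra.
apply/(mulfI (lt0r_neq0 s_gt0)).
apply/eqP; rewrite -subr_eq0; apply/eqP.
(* Multiplied by s, the two sides differ by a multiple of the relation s2. *)
transitivity ((s ^+ 2 - (x ^+ 2 + 4)) * s * (x + 1) / 2 : R).
  by field; rewrite lt0r_neq0.
by rewrite s2; ring.
Qed.

Theorem theorem5p8 (R : rcfType) (r : nat) (hr : (1 <= r)%N) (G : mixed_graph)
    (hG : excess_graph R r 1 3 1 G) :
  totally_regular G.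
Proof.
case: hG => geo d_ge out_ge orderG.
have {}orderG : #|G|%:R = r%:R ^+ 3 + 2 * r%:R ^+ 2 + 4 * r%:R + 5 :> int.
  have -> : #|G| = (r ^ 3 + 2 * r ^ 2 + 4 * r + 4 + 1)%N.
    by apply/eqP; rewrite -(eqr_nat R) orderG moore_bound_arc1_len3 // -natrD.
  ring.
have udeg_ge (u : G) : r%:R <= udeg u by rewrite -udegE ler_nat.
have odeg_ge (u : G) : 1 <= odeg u by rewrite -odegE (ler_nat _ 1).
have reg := out_degrees udeg_ge odeg_ge geo orderG.
have udeg_r u := (reg u).1; have odeg_1 u := (reg u).2.
have nat_inj (m n : nat) : m%:R = n%:R :> int -> m = n.
  by move/eqP; rewrite eqr_nat => /eqP.
split=> [u v|u].
  by split; apply: nat_inj;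
    rewrite ?udegE ?odegE ?udeg_r ?odeg_1.
apply: nat_inj; rewrite in_degreeE odegE odeg_1.
have r_ge1 : 1 <= r%:R :> int by rewrite (ler_nat _ 1).
apply/eqP; rewrite -subr_eq0; apply/eqP.
exact: (surplus_eq0 r_ge1 udeg_r odeg_1 geo orderG).
Qed.
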